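(* Let $S$ be a unit-additive ring. Let $k=U(S)\cup\mathcal{N}(S)$, which is a subring of $S$. Let $R$ be a $k$-subalgebra of $S$. Then $R$ is unit-additive.
   Context: All rings are commutative and unital. $U(S)$ is the group of units and $\mathcal{N}(S)$ the nilradical of $S$. A ring $R$ is unit-additive if whenever $u,v$ are units of $R$, $u+v$ is either a unit of $R$ or a nilpotent element. For a unit-additive ring $S$, the set $U(S)\cup\mathcal{N}(S)$ is a subring of $S$; a $k$-subalgebra of $S$ is a subring of $S$ containing $k$. *)

(* Defs.v *)
From mathcomp Require Import all_boot all_algebra.
From mathcomp Require Import boolp classical_sets.

Set Implicit Arguments.
Unset Strict Implicit.
Unset Printing Implicit Defensive.

Import GRing.Theory.
Local Open Scope ring_scope.
Local Open Scope classical_set_scope.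

(* Rings are [comPzRingType], so that the zero ring is allowed. MathComp's
   [GRing.unit] needs a nontrivial [unitRingType], hence the definition of
   units below; [units_unitE] shows that the two agree when both make sense. *)
Definition units (S : comPzRingType) : set S :=
  [set x | exists y : S, x * y = 1].

Definition nilradical (S : comPzRingType) : set S :=
  [set x | exists n : nat, x ^+ n = 0].

Definition unit_additive (S : comPzRingType) : Prop :=
  forall u v : S, units u -> units v -> units (u + v) \/ nilradical (u + v).

Lemma units_unitE (S : comUnitRingType) (x : S) :
  units x <-> x \is a GRing.unit.
Proof.
split=> [[y xy1]|Ux]; last by exists x^-1; rewrite divrr.
by apply/unitrP; exists y; rewrite mulrC.
Qed.

Section UnitsNilradical.
Variable S : comPzRingType.
Implicit Types x y u v : S.

Lemma units1 : units (1 : S).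
Proof. by exists 1; rewrite mulr1. Qed.

Lemma unitsN u : units u -> units (- u).
Proof. by case=> v uv; exists (- v); rewrite mulrNN. Qed.

Lemma unitsM u v : units u -> units v -> units (u * v).
Proof. by case=> a ua [b vb]; exists (a * b); rewrite mulrACA ua vb mulr1. Qed.

Lemma nilradicalM x y : nilradical x -> nilradical (x * y).
Proof. by case=> n xn; exists n; rewrite exprMn xn mul0r. Qed.

Lemma nilradicalN x : nilradical x -> nilradical (- x).
Proof. by move=> /(@nilradicalM _ (- 1)); rewrite mulrN1. Qed.

Lemma nilradicalD x y : nilradical x -> nilradical y -> nilradical (x + y).
Proof.
case=> m xm [n yn]; exists (m + n)%N; rewrite exprDn big1 // => i _.
have [le_ni|lt_in] := leqP n i.
  by rewrite -(subnK le_ni) (exprD y) yn !mulr0 mul0rn.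
have /subnK <- : (m <= m + n - i)%N by rewrite -addnBA ?leq_addr // ltnW.
by rewrite exprD xm mulr0 mul0r mul0rn.
Qed.

Lemma unitsDnil u x : units u -> nilradical x -> units (u + x).
Proof.
case=> v uv [n xn0].
have xn : (- x) ^+ n = 0 by rewrite exprNn xn0 mulr0.
have := subrXX u (- x) n; rewrite xn subr0 opprK.
set s := \sum_(_ < _) _ => us; exists (s * v ^+ n).
by rewrite mulrA -us -exprMn uv expr1n.
Qed.

Lemma units_nilradical_subring : unit_additive S ->
  GRing.subring_closed (mem (@units S `|` @nilradical S)).
Proof.
move=> addS; split=> [|x y|x y]; rewrite ?inE /=; first by left; exact: units1.
- move=> [Ux|Nx] [Uy|Ny].
  + by apply: addS => //; exact: unitsN.
  + by left; apply: unitsDnil => //; exact: nilradicalN.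
  + by left; rewrite addrC; apply: unitsDnil => //; exact: unitsN.
  + by right; apply: nilradicalD => //; exact: nilradicalN.
- move=> [Ux|Nx] [Uy|Ny]; first by left; exact: unitsM.
  + by right; rewrite mulrC; exact: nilradicalM.
  + by right; exact: nilradicalM.
  + by right; exact: nilradicalM.
Qed.

End UnitsNilradical.

(* Main.v *)
Require Import Defs.
From mathcomp Require Import all_boot all_algebra.
From mathcomp Require Import boolp classical_sets.

Local Open Scope ring_scope.
Local Open Scope classical_set_scope.

Import GRing.Theory.

(** Units of [R] stay units in [S], so their sum is a unit or nilpotent in [S]. Both outcomes
    descend to [R]: nilpotency by [nilradical_val], invertibility by [units_val], as [R] contains
    every unit of [S]. *)

Lemma units_rmorph (R S : comPzRingType) (f : {rmorphism R -> S}) (x : R) :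
  units x -> units (f x).
Proof. by case=> y xy1; exists (f y); rewrite -rmorphM xy1 rmorph1. Qed.

(** Since the inclusion is injective, the same exponent works in [R]. *)
Lemma nilradical_val (S : comPzRingType) (P : {pred S})
    (R : subComPzRingType P) (x : R) :
  nilradical (\val x) -> nilradical x.
Proof. by case=> n xn0; exists n; apply: val_inj; rewrite rmorphXn rmorph0. Qed.

(* An inverse in [S] is itself a unit of [S], so it already lies in [R]. *)
Lemma units_val (S : comPzRingType) (P : {pred S}) (R : subComPzRingType P)
    (hP : @units S `<=` [set` P]) (x : R) :
  units (\val x) -> units x.
Proof.
case=> y xy1.
have Py : y \in P by apply: hP; exists (\val x); rewrite mulrC.
by exists (Sub y Py); apply: val_inj; rewrite rmorphM rmorph1 /= SubK.
Qed.

(* A subring of S is a [subComPzRingType P], i.e. a commutative ring structure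
   on the subtype of the elements of S satisfying P whose inclusion [val] into
   S is a (unital) ring morphism. *)
Theorem proposition2p7 (S : comPzRingType) (hS : unit_additive S)
    (P : {pred S}) (R : subComPzRingType P)
    (hkR : @units S `|` @nilradical S `<=` [set` P]) :
  unit_additive R.
Proof.
move=> u v /(units_rmorph R S \val) Uu /(units_rmorph R S \val) Uv.
(* The dichotomy in [S] becomes one about [\val (u + v)], ready for descent. *)
have := hS _ _ Uu Uv; rewrite -rmorphD => -[Uuv|Nuv].
- by left; apply: units_val Uuv => x Ux; apply: hkR; left.
- by right; exact: nilradical_val Nuv.
Qed.
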